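(* Let $N_1,\ldots,N_r\ge 2$ be integers, let $1\le k<r$, and set $m=N_1\cdots N_k$ and $n=N_{k+1}\cdots N_r$. Let $\underline{z}_1,\ldots,\underline{z}_{mn}$ be vectors of length $r$, and write $\underline{z}_i=(\underline{z}'_i,\underline{z}''_i)$ with $\underline{z}'_i=(z_i^{(1)},\ldots,z_i^{(k)})$ and $\underline{z}''_i=(z_i^{(k+1)},\ldots,z_i^{(r)})$. Then the multivariable Vandermonde determinant satisfies $$\det V_{(N_1,\ldots,N_r)}(\underline{z}_1,\ldots,\underline{z}_{mn})=\sum_{\alpha,\beta}\Phi_{\alpha,\beta}\ \prod_{i=1}^n\det V_{(N_1,\ldots,N_k)}\bigl(\underline{z}'_l,\ l\in\mathrm{col}_i(\alpha)\bigr)\ \prod_{j=1}^m\det V_{(N_{k+1},\ldots,N_r)}\bigl(\underline{z}''_l,\ l\in\mathrm{row}_j(\beta)\bigr),$$ where the sum is over all pairs $\alpha,\beta$ of standard tableaux of shape $n^m$, and the $\Phi_{\alpha,\beta}$ are certain integers (constants, not depending on the vectors $\underline{z}_i$). Here $\mathrm{col}_i(\alpha)$ denotes the set of elements in the $i$-th column of $\alpha$, in ascending order, and likewise $\mathrm{row}_j(\beta)$ denotes the set of elements in the $j$-th row of $\beta$, in ascending order.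
   Context: Vandermonde matrices. For integers $M_1,\ldots,M_s\ge 2$ with product $M=M_1\cdots M_s$, let $(e_1,\ldots,e_M)$ be the monomials in $s$ variables $z^{(1)},\ldots,z^{(s)}$ which are of degree $\le M_t-1$ in each $z^{(t)}$, ordered degree-lexicographically: first with respect to the total degree (from smallest to largest), and then within each degree by the lexicographic order (for instance, for $(M_1,M_2)=(2,2)$ the list is $1,\ z^{(1)},\ z^{(2)},\ z^{(1)}z^{(2)}$). For vectors $\underline{z}_1,\ldots,\underline{z}_M$ of length $s$, $V_{(M_1,\ldots,M_s)}(\underline{z}_1,\ldots,\underline{z}_M)$ is the $M\times M$ matrix with $(i,j)$ entry $e_j(\underline{z}_i)$. Tableaux. A standard Young tableau of shape $n^m=(n,\ldots,n)$ is an array of boxes with $m$ rows and $n$ columns in which the numbers $1,\ldots,mn$ are placed, each once, so that every row is increasing from left to right and every column is increasing from top to bottom. *)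

(* Defs.v *)
From HB Require Import structures.
From mathcomp Require Import all_boot all_order all_algebra.

Set Implicit Arguments.
Unset Strict Implicit.
Unset Printing Implicit Defensive.

Import Order.TTheory GRing.Theory.

(* A monomial in s variables is encoded by the list of its s exponents. *)
Fixpoint box (M : seq nat) : seq (seq nat) :=
  if M is d :: M' then [seq a :: e | a <- iota 0 d, e <- box M'] else [:: [::]].

(* Within a degree the lexicographic order is that of words in the letters
   z_1 < z_2 < ..., so that z_1^2, z_1 z_2, z_2^2 come in this order: exponent
   lists are compared lexicographically, the larger one coming first. *)
Definition deglex (e f : seq nat) : bool :=
  (sumn e < sumn f) ||
  ((sumn e == sumn f) && ((f : seqlexi nat) <= (e : seqlexi nat))%O).

Definition monomials (M : seq nat) : seq (seq nat) := sort deglex (box M).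

Lemma size_monomials (M : seq nat) :
  size (monomials M) = \prod_(d <- M) d.
Proof.
rewrite size_sort; elim: M => [|d M IH] /=; first by rewrite big_nil.
by rewrite big_cons size_allpairs size_iota IH.
Qed.

Example monomials22 :
  monomials [:: 2; 2] = [:: [:: 0; 0]; [:: 1; 0]; [:: 0; 1]; [:: 1; 1]].
Proof. by vm_compute. Qed.

Example monomials33 :
  monomials [:: 3; 3] =
    [:: [:: 0; 0]; [:: 1; 0]; [:: 0; 1]; [:: 2; 0]; [:: 1; 1]; [:: 0; 2];
        [:: 2; 1]; [:: 1; 2]; [:: 2; 2]].
Proof. by vm_compute. Qed.

Definition monomial_eval (R : comNzRingType) (e : seq nat) (z : seq R) : R :=
  (\prod_(t < size e) nth 0 z t ^+ nth 0%N e t)%R.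

(* The points are given as a list, which is meant to have \prod_(d <- M) d
   entries, each of length size M; the defaults of nth are then never used. *)
Definition mvandermonde (R : comNzRingType) (M : seq nat) (zs : seq (seq R)) :
    'M[R]_(\prod_(d <- M) d) :=
  (\matrix_(i, j) monomial_eval (nth [::] (monomials M) j) (nth [::] zs i))%R.

(* Tableaux of shape n^m have entries 0, ..., mn-1 instead of 1, ..., mn. Each
   entry occurs exactly once as soon as the filling is injective, since there
   are mn boxes. *)
Definition standard (m n : nat) (a : 'M['I_(m * n)]_(m, n)) : bool :=
  [&& injectiveb (fun c : 'I_m * 'I_n => a c.1 c.2),
      [forall i : 'I_m, forall j : 'I_n, forall j' : 'I_n, (j < j') ==> (a i j < a i j')] &
      [forall j : 'I_n, forall i : 'I_m, forall i' : 'I_m, (i < i') ==> (a i j < a i' j)]].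

(* enum lists a set of ordinals in ascending order. *)
Definition tab_col (m n : nat) (a : 'M['I_(m * n)]_(m, n)) (i : 'I_n) :
    seq 'I_(m * n) := enum [set a j i | j : 'I_m].

Definition tab_row (m n : nat) (a : 'M['I_(m * n)]_(m, n)) (j : 'I_m) :
    seq 'I_(m * n) := enum [set a j i | i : 'I_n].

Lemma size_tab_col (m n : nat) (a : 'M['I_(m * n)]_(m, n)) (i : 'I_n) :
  standard a -> size (tab_col a i) = m.
Proof.
case/and3P=> /injectiveP inj_a _ _.
rewrite -cardE card_imset ?card_ord // => j j' eq_a.
by have [] := inj_a (j, i) (j', i) eq_a.
Qed.

Lemma size_tab_row (m n : nat) (a : 'M['I_(m * n)]_(m, n)) (j : 'I_m) :
  standard a -> size (tab_row a j) = n.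
Proof.
case/and3P=> /injectiveP inj_a _ _.
rewrite -cardE card_imset ?card_ord // => i i' eq_a.
by have [] := inj_a (j, i) (j, i') eq_a.
Qed.

(* Main.v *)
Require Import Defs.
From HB Require Import structures.
From mathcomp Require Import all_boot all_order all_algebra.
From mathcomp Require Import fingroup perm.
Import Order.TTheory GRing.Theory Num.Theory.

(** Every monomial of the big Vandermonde matrix is the product of a monomial in
    the first k variables and one in the others.  So the determinant is
    [det (X i (a j) * Y i (b j))], where the N x m matrix X and the N x n matrix Y
    (N = m n) hold the values of the two kinds of monomials.  Expanding it gives
    integers C(f, g), indexed by words f : [N] -> [m] and g : [N] -> [n], such
    that the determinant is the sum of C(f, g) prod_p X(p, f p) prod_p Y(p, g p).
    Transposing two rows of both factors changes the sign:
    C(f tau, g tau) = - C(f, g).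

    Fix g.  Among any n + 1 positions, two carry the same letter of g, so that
    exchanging them in f alone changes the sign of C(f, g).  Hence the sum of
    C(-, g) over all rearrangements of f on these positions is zero: C(-, g)
    satisfies the Garnir relations ([alternating_garnir]).  The coefficients of a
    product of minors of X over the columns of a filling satisfy them for the same
    reason ([column_minors_garnir]).

    The functions satisfying the Garnir relations form a free abelian group with
    the column minors of standard tableaux as a basis ([standard_basis]).
    - Such a function is determined by its values on the row words of standard
      tableaux.  If f is nonincreasing on a set P of n + 1 positions, every other
      rearrangement of f on P is lexicographically smaller, so the relation
      determines the value at f from smaller words ([garnir_vanish]).  A word
      without such a set P is the row word of a standard tableau
      ([standard_word_exists]).
    - The values of the column minors of a standard tableau a on the row words of
      standard tableaux b form a unitriangular matrix for the lexicographic order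
      ([column_minors_row_word], [column_minors_lexrank]), and this matrix has an
      integer inverse ([unitriangular_inverse]).

    The coordinates in this basis are integer combinations of values.  Therefore
    the basis can be used in the variable f and then, with rows and columns
    exchanged, in the variable g, which writes C as an integer combination of
    products of the two kinds of basis functions ([product_det_standard]). *)

(** * Unitriangular integer matrices *)

Section UnitriangularInverse.

Local Open Scope ring_scope.

(** Only the identity contributes to the determinant: a permutation with a nonzero
    term never decreases [k], and as it preserves the total of [k] it must fix every
    index. *)
Lemma unitriangular_det (n : nat) (k : 'I_n -> nat) (A : 'M[int]_n) :
  (forall i, A i i = 1) -> (forall i j, i != j -> A i j != 0 -> (k i < k j)%N) ->
  \det A = 1.
Proof.
move=> A1 Alt; rewrite /determinant (bigD1 (1%g : 'S_n)) //= odd_perm1 mul1r.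
rewrite [X in X + _]big1 => [|i _]; last by rewrite perm1 A1.
rewrite big1 ?addr0 // => s /eqP s1; apply/eqP; rewrite mulf_eq0 signr_eq0 /=.
apply/negPn; rewrite prodf_seq_neq0; apply/negP => /allP s_neq0; case: s1.
have s_le i : (k i <= k (s i) ?= iff (s i == i))%N.
  have := s_neq0 i (mem_index_enum i); rewrite /= => Ai.
  have [->|ne] := eqVneq (s i) i; first by split; rewrite ?eqxx.
  have lt := Alt i (s i) _ Ai; rewrite eq_sym in ne; move: (lt ne) => {}lt.
  by split; [exact: ltnW | rewrite ltn_eqF].
have [_] := leqif_sum (fun i (_ : true) => s_le i).
rewrite [X in (_ == X)%N](_ : _ = (\sum_i k i)%N); last first.
  by rewrite [RHS](reindex_inj (@perm_inj _ s)).
rewrite eqxx => /esym/forallP s_id; apply/permP => i.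
by rewrite perm1; apply/eqP; have := s_id i.
Qed.

(** The inverse exists over the integers, which is where the integrality of the
    straightening coefficients comes from. *)
Lemma unitriangular_inverse (T : finType) (k : T -> nat) (A : T -> T -> int) :
  (forall x, A x x = 1) -> (forall x y, x != y -> A x y != 0 -> (k x < k y)%N) ->
  exists B : T -> T -> int, forall x y, \sum_z B x z * A z y = (x == y)%:R.
Proof.
move=> A1 Alt.
pose M : 'M[int]_#|T| := \matrix_(i, j) A (enum_val i) (enum_val j).
have uM : M \in unitmx.
  rewrite unitmxE (@unitriangular_det _ (k \o enum_val)) ?unitr1 // => i.
    by rewrite mxE A1.
  move=> j ij; rewrite mxE; apply: Alt.
  by apply: contra ij => /eqP/enum_val_inj ->.
exists (fun x y => invmx M (enum_rank x) (enum_rank y)) => x y.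
have := congr1 (fun M' : 'M[int]_#|T| => M' (enum_rank x) (enum_rank y)) (mulVmx uM).
rewrite !mxE (inj_eq enum_rank_inj) => <-.
rewrite (reindex (fun i : 'I_#|T| => enum_val i)) /=; last first.
  by apply: onW_bij; exact: enum_val_bij.
by apply: eq_bigr => i _; rewrite enum_valK mxE enum_rankK.
Qed.

End UnitriangularInverse.

(** * Lexicographic order of words *)

Definition lexrank {N m : nat} (f : {ffun 'I_N -> 'I_m}) : nat :=
  Order.enum_rank ([tuple f p | p < N] : N.-tuplelexi 'I_m).

Lemma lexrank_lt {N m : nat} (f g : {ffun 'I_N -> 'I_m}) (p : 'I_N) :
  (forall q : 'I_N, q < p -> f q = g q) -> f p < g p -> lexrank f < lexrank g.
Proof.
move=> fg_eq fg_lt; rewrite /lexrank.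
have lt : (([tuple f p | p < N] : N.-tuplelexi 'I_m) <
           ([tuple g p | p < N] : N.-tuplelexi 'I_m))%O.
  by apply/ltxi_tuplePlt; exists p => [q qp|]; rewrite !tnth_mktuple // fg_eq.
rewrite ltnNge; apply: contraL lt => le; rewrite -leNgt.
by rewrite -(Order.le_enum_rank le_total).
Qed.

Lemma first_difference {N m : nat} {f g : {ffun 'I_N -> 'I_m}} :
  f != g -> exists2 p : 'I_N, f p != g p & forall q : 'I_N, q < p -> f q = g q.
Proof.
move=> fg; have [p0 p0P] : exists p0, f p0 != g p0.
  apply/existsP; rewrite -negb_forall; apply: contra fg => /forallP fg.
  by apply/eqP/ffunP => p; apply/eqP.
case: (@arg_minnP _ p0 (fun p => f p != g p) (fun p : 'I_N => p : nat) p0P) => p fgp p_min.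
by exists p => // q qp; apply/eqP; apply: contraTT qp => /p_min; rewrite -leqNgt.
Qed.

(** * Garnir relations *)

Section Garnir.

Local Open Scope ring_scope.

Context {N m : nat}.
Implicit Types (f : {ffun 'I_N -> 'I_m}) (c : {ffun 'I_N -> 'I_m} -> int).
Implicit Types (P : {set 'I_N}) (s : 'S_N).

Definition rearrange f s : {ffun 'I_N -> 'I_m} := [ffun p => f (s p)].

Lemma rearrangeM f s t : rearrange (rearrange f s) t = rearrange f (t * s)%g.
Proof. by apply/ffunP => p; rewrite !ffunE permM. Qed.

Definition rearrangement P f f' : bool :=
  [exists s : 'S_N, perm_on P s && (f' == rearrange f s)].

(** The sum runs over the distinct words that arise by permuting letters within
    [P], not over the permutations: the word [f] itself then has coefficient 1,
    so that its value can be solved for without division. *)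
Definition garnir (n : nat) c : Prop :=
  forall P f, (n < #|P|)%N -> \sum_(f' | rearrangement P f f') c f' = 0.

Lemma garnir_sum {I : finType} (n : nat) (D : pred I) (x : I -> int)
    (c : I -> {ffun 'I_N -> 'I_m} -> int) :
  (forall i, D i -> garnir n (c i)) -> garnir n (fun f => \sum_(i | D i) x i * c i f).
Proof.
move=> cG P f nP; rewrite exchange_big big1 //= => i Di.
by rewrite -mulr_sumr cG ?mulr0.
Qed.

Lemma garnir_sub (n : nat) (c d : {ffun 'I_N -> 'I_m} -> int) :
  garnir n c -> garnir n d -> garnir n (fun f => c f - d f).
Proof. by move=> cG dG P f nP; rewrite sumrB cG // dG // subr0. Qed.

(** By pigeonhole [P] has two positions with the same value of [g].  Exchanging
    them permutes the words of the relation and changes the sign of every term, so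
    the sum is equal to its opposite. *)
Lemma alternating_garnir {n : nat} (g : 'I_N -> 'I_n) c :
  (forall p q f, p != q -> g p = g q -> c (rearrange f (tperm p q)) = - c f) ->
  garnir n c.
Proof.
move=> c_alt P f nP.
have [p pP [q qP [pq gpq]]] :
    exists2 p, p \in P & exists2 q, q \in P & p != q /\ g p = g q.
  have /dinjectivePn[p pP [q /andP[qp qP] gpq]] : ~~ dinjectiveb g P.
    apply: contraL nP => /dinjectiveP/card_in_imset <-.
    by rewrite -leqNgt -[X in (_ <= X)%N]card_ord max_card.
  by exists p => //; exists q => //; rewrite eq_sym.
have tP : perm_on P (tperm p q).
  by apply: subset_trans (tperm_on p q) _; apply/subsetP => x /set2P[] ->.
set S := \sum_(_ | _) _; suff : S = - S by move/esym/eqP; rewrite eqNr => /eqP.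
rewrite {1}/S (reindex_inj (h := fun f' => rearrange f' (tperm p q))) /=; last first.
  move=> f1 f2 /(congr1 (rearrange^~ (tperm p q))).
  rewrite !rearrangeM tperm2 => e; apply/ffunP => x.
  by have := congr1 (fun h : {ffun _} => h x) e; rewrite !ffunE perm1.
rewrite /S -sumrN; apply: eq_big => [f'|f' _]; last exact: c_alt.
apply/existsP/existsP => -[s /andP[sP /eqP e]]; exists (tperm p q * s)%g.
  rewrite perm_onM //= -rearrangeM -e rearrangeM tperm2.
  by apply/eqP/ffunP => x; rewrite ffunE perm1.
by rewrite perm_onM //= e rearrangeM.
Qed.

(** At the first position [p] of [P] where the letters differ, [f'] cannot have the
    larger one: all letters of [f] on [P] beyond [f p] stand before [p], where [f']
    agrees with [f], so [f'] would have one more of them than [f] has. *)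
Lemma rearrangement_lexrank P f f' :
    (forall p q : 'I_N, p \in P -> q \in P -> (p <= q)%N -> (f q <= f p)%N) ->
  rearrangement P f f' -> f' != f -> (lexrank f' < lexrank f)%N.
Proof.
move=> f_dec /existsP[s /andP[sP /eqP ef']] ne.
have [p nep eqf] := first_difference ne.
apply: (@lexrank_lt _ _ _ _ p) => //.
have pP : p \in P.
  by apply: contraR nep => /(out_perm sP) sp; rewrite ef' ffunE sp.
rewrite ltnNge leq_eqVlt eq_sym negb_or nep /= -leqNgt leqNgt; apply/negP => lt.
pose A (h : {ffun 'I_N -> 'I_m}) := [set q in P | (f p < h q)%N].
have : (#|A f| < #|A f'|)%N.
  apply: proper_card; apply/properP; split; last first.
    by exists p; rewrite !inE pP //= ltnn.
  apply/subsetP => q; rewrite !inE => /andP[qP fpq]; rewrite qP /= eqf //.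
  by apply: contraLR fpq; rewrite -!leqNgt; exact: f_dec.
have -> : A f' = s @^-1: A f.
  apply/setP => q; rewrite !inE ef' ffunE; congr (_ && _).
  by rewrite (perm_closed _ sP).
rewrite -[X in (_ < X)%N](card_imset _ (@perm_inj _ s)).
by rewrite ltnNge subset_leq_card //; apply/subsetP => _ /imsetP[q + ->]; rewrite inE.
Qed.

(** By induction on the lexicographic order: in the relation for a set on which [f]
    is nonincreasing, all terms but the one at [f] are at smaller words. *)
Lemma garnir_vanish (n : nat) c :
    garnir n c ->
    (forall f, (forall P, (n < #|P|)%N ->
       ~ (forall p q : 'I_N, p \in P -> q \in P -> (p <= q)%N -> (f q <= f p)%N)) ->
     c f = 0) ->
  forall f, c f = 0.
Proof.
move=> cG c_std f; have [k] := ubnP (lexrank f).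
elim: k f => // k IH f; rewrite ltnS => fk.
pose dec P := [forall p : 'I_N, forall q : 'I_N,
  [&& p \in P, q \in P & (p <= q)%N] ==> (f q <= f p)%N].
have [/existsP[P /andP[nP /forallP P_dec]]|no_dec] :=
    boolP [exists P : {set 'I_N}, (n < #|P|)%N && dec P].
  have f_dec p q : p \in P -> q \in P -> (p <= q)%N -> (f q <= f p)%N.
    move=> pP qP pq; move/forallP: (P_dec p) => /(_ q).
    by rewrite pP qP pq.
  have ff : rearrangement P f f.
    apply/existsP; exists 1%g; rewrite perm_on1 /=.
    by apply/eqP/ffunP => p; rewrite ffunE perm1.
  have := cG P f nP; rewrite (bigD1 f) //= big1 ?addr0 // => f' /andP[f'P ne].
  by apply: IH; apply: leq_trans fk; exact: rearrangement_lexrank f'P ne.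
apply: c_std => P nP f_dec; case/existsP: no_dec; exists P; rewrite nP.
by apply/forallP => p; apply/forallP => q; apply/implyP => /and3P[]; exact: f_dec.
Qed.

End Garnir.

(** * Standard fillings and their column minors *)

Section Tableaux.

Context {N m n : nat}.
Implicit Types (a : 'M['I_N]_(m, n)) (f : {ffun 'I_N -> 'I_m}).

(** The condition of [standard] with the number of entries as a separate parameter,
    since the shapes m x n and n x m both have to be filled with the same entries. *)
Definition standard_filling a : bool :=
  [&& injectiveb (fun u : 'I_m * 'I_n => a u.1 u.2),
      [forall i : 'I_m, forall j : 'I_n, forall j' : 'I_n,
         (j < j') ==> (a i j < a i j')] &
      [forall j : 'I_n, forall i : 'I_m, forall i' : 'I_m,
         (i < i') ==> (a i j < a i' j)]].

(** If [a] is standard and N = m n, every entry occurs in [a] and the default [x0] is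
    never taken. *)
Definition row_word (x0 : 'I_m) a : {ffun 'I_N -> 'I_m} :=
  [ffun p => odflt x0 [pick x | [exists j, a x j == p]]].

(** The coefficient of prod_p X(p, f p) in the product of the minors of a matrix X
    with rows indexed by the entries, one minor for each column of [a]; see
    [column_minors_expansion]. *)
Definition column_minors a f : int :=
  (\prod_(j < n) \det (\matrix_(i < m, x < m) (f (a i j) == x)%:R))%R.

Lemma filling_inj {a} : standard_filling a ->
  forall i j i' j', a i j = a i' j' -> (i, j) = (i', j').
Proof. by case/and3P=> /injectiveP a_inj _ _ i j i' j' /(a_inj (i, j) (i', j')). Qed.

Lemma filling_row_lt {a} : standard_filling a ->
  forall i (j j' : 'I_n), j < j' -> a i j < a i j'.
Proof.
by case/and3P=> _ /forallP arow _ i j j'; apply/implyP; move/forallP/(_ j)/forallP: (arow i).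
Qed.

Lemma filling_column_lt {a} : standard_filling a ->
  forall (i i' : 'I_m) j, i < i' -> a i j < a i' j.
Proof.
by case/and3P=> _ _ /forallP acol i i' j; apply/implyP; move/forallP/(_ i)/forallP: (acol j).
Qed.

Lemma filling_bij {a} : N = m * n -> standard_filling a ->
  exists2 h : 'I_N -> 'I_m * 'I_n,
    cancel (fun u => a u.1 u.2) h & cancel h (fun u => a u.1 u.2).
Proof.
move=> hN /and3P[/injectiveP a_inj _ _]; have [|h] := inj_card_bij a_inj.
  by rewrite card_prod !card_ord hN.
by exists h.
Qed.

Lemma row_wordE {a} x0 : standard_filling a -> forall x j, row_word x0 a (a x j) = x.
Proof.
move=> sa x j; rewrite ffunE; case: pickP => [x' /existsP[j' /eqP/(filling_inj sa)[]] //|].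
by move/(_ x)/existsP; case; exists j.
Qed.

Lemma row_word_unique {a} x0 f : N = m * n -> standard_filling a ->
  (forall x j, f (a x j) = x) -> row_word x0 a = f.
Proof.
move=> hN sa fa; apply/ffunP => p; have [h _ hK] := filling_bij hN sa.
by rewrite -(hK p) row_wordE // fa.
Qed.

(** Exchanging two letters of [f] at entries of the same column of [a] exchanges two
    rows of the determinant of that column and leaves the other columns alone. *)
Lemma column_minors_alternating {a} {h : 'I_N -> 'I_m * 'I_n} :
    cancel (fun u => a u.1 u.2) h -> cancel h (fun u => a u.1 u.2) ->
  forall p q f, p != q -> (h p).2 = (h q).2 ->
  column_minors a (rearrange f (tperm p q)) = (- column_minors a f)%R.
Proof.
move=> aK hK p q f; case: (h p) (hK p) => [i j] /= <-; case: (h q) (hK q) => [i' j'] /= <-.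
move=> ne jj'; rewrite -{j'}jj' in ne *.
rewrite /column_minors (bigD1 j) //= [in RHS](bigD1 j) //= -mulNr.
congr (_ * _)%R; last first.
  apply: eq_bigr => j1 j1j; congr (\det _)%R; apply/matrixP => i1 x; rewrite !mxE ffunE.
  have tne i2 : a i2 j != a i1 j1.
    by apply: contra j1j => /eqP/(can_inj aK (x1 := (i2, j)) (x2 := (i1, j1)))-[_ ->].
  by rewrite tpermD.
have ii' : i != i' by apply: contra ne => /eqP ->.
set A := (X in (- \det X)%R).
have -> : (\matrix_(i1, x) (rearrange f (tperm (a i j) (a i' j)) (a i1 j) == x)%:R =
  xrow i i' A)%R.
  apply/matrixP => i1 x; rewrite !mxE ffunE; congr (f _ == x)%:R%R.
  have a_inj : injective (a^~ j) by move=> i2 i3 /(can_inj aK (x1 := (i2, j)) (x2 := (i3, j)))-[].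
  by rewrite -(inj_tperm _ _ _ a_inj).
by rewrite xrowE det_mulmx det_perm odd_tperm ii' expr1 mulN1r.
Qed.

Lemma column_minors_garnir {a} : N = m * n -> standard_filling a ->
  garnir n (column_minors a).
Proof.
move=> hN sa; have [h aK hK] := filling_bij hN sa.
exact: (@alternating_garnir _ _ _ (fun p => (h p).2)) (column_minors_alternating aK hK).
Qed.

Lemma column_minors_row_word {a} x0 : standard_filling a ->
  column_minors a (row_word x0 a) = 1%R.
Proof.
move=> sa; rewrite /column_minors big1 // => j _; rewrite -[RHS](det1 _ m).
by congr (\det _)%R; apply/matrixP => i x; rewrite !mxE row_wordE.
Qed.

(** Suppose that [f] has a smaller letter x than the row word at the first entry
    a i j where they differ.  The entry a x j is above it, hence smaller, so [f]
    agrees with the row word there and has the letter x twice in column j: the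
    minor of that column vanishes. *)
Lemma column_minors_lexrank {a} x0 f : N = m * n -> standard_filling a ->
  column_minors a f != 0%R -> f != row_word x0 a -> lexrank (row_word x0 a) < lexrank f.
Proof.
move=> hN sa af ne; have [p nep eqf] := first_difference ne.
apply: (@lexrank_lt _ _ _ _ p) => [q /eqf -> //|].
rewrite ltnNge leq_eqVlt negb_or nep /=; apply: contra af => lt.
have [h _ hK] := filling_bij hN sa; move: (h p) (hK p) => [i j] /= ap.
rewrite -{}ap row_wordE // in lt eqf *.
have eqi : f (a (f (a i j)) j) = f (a i j).
  by rewrite eqf ?row_wordE // filling_column_lt.
rewrite /column_minors (bigD1 j) //= mulf_eq0; apply/orP; left.
rewrite (@determinant_alternate _ _ _ i (f (a i j))) //; last by move=> x; rewrite !mxE eqi.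
by rewrite neq_ltn lt orbT.
Qed.

(** The bound on the number of occurrences of each letter is an equality because the
    total is m n; row x then lists the positions of the letter x in order. *)
Lemma increasing_filling_exists f : N = m * n ->
    (forall x, #|[set p | f p == x]| <= n) ->
  exists a, [/\ forall x j, f (a x j) = x,
    forall x (j j' : 'I_n), j < j' -> a x j < a x j' &
    injective (fun u : 'I_m * 'I_n => a u.1 u.2)].
Proof.
move=> hN Fn; pose F x := [set p | f p == x].
have sF : \sum_x #|F x| = N.
  rewrite -[RHS]card_ord -sum1_card (partition_big f predT) //=.
  by apply: eq_bigr => x _; rewrite -sum1_card; apply: eq_bigl => p; rewrite inE.
have cF x : #|F x| = n.
  have Fn' x' : #|F x'| <= n ?= iff (#|F x'| == n) by split; [exact: Fn|].
  have [_] := leqif_sum (fun x' (_ : true) => Fn' x').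
  by rewrite sum_nat_const card_ord -hN sF eqxx => /esym/forallP/(_ x)/eqP.
have aF x (j : 'I_n) : Order.enum_val (cast_ord (esym (cF x)) j) \in F x.
  exact: Order.enum_valP.
pose a := (\matrix_(x, j) Order.enum_val (cast_ord (esym (cF x)) j))%R.
have fa x j : f (a x j) = x by rewrite mxE; have := aF x j; rewrite inE => /eqP.
have lta x (j j' : 'I_n) : j < j' -> a x j < a x j'.
  move=> jj'; rewrite !mxE.
  have := leW_mono (Order.le_enum_val (@le_total _ 'I_N) (A := F x)).
  move=> /(_ (cast_ord (esym (cF x)) j) (cast_ord (esym (cF x)) j')).
  by rewrite !ltEord /= jj' => ->.
exists a; split=> // -[x j] [x' j'] /= e.
have xx' : x = x' by rewrite -(fa x j) e fa.
rewrite -{}xx' in e *; suff -> : j = j' by [].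
by case: (ltngtP j j') => [/(lta x)|/(lta x)|/val_inj //]; rewrite e ltnn.
Qed.

(** If some column j were not increasing, with a x' j < a x j in rows x < x', the n + 1
    entries a x' 0, ..., a x' j, a x j, ..., a x (n - 1) would be a set on which [f] is
    nonincreasing: it has the letter x' on the former and x on the latter. *)
Lemma standard_word_exists x0 f : N = m * n ->
    (forall P : {set 'I_N}, n < #|P| ->
       ~ (forall p q : 'I_N, p \in P -> q \in P -> p <= q -> f q <= f p)) ->
  exists2 a, standard_filling a & row_word x0 a = f.
Proof.
move=> hN f_ndec.
have [|a [fa lta a_inj]] := increasing_filling_exists f hN.
  move=> x; rewrite leqNgt; apply/negP => /f_ndec; apply=> p q.
  by rewrite !inE => /eqP -> /eqP ->.
suff sa : standard_filling a by exists a => //; exact: row_word_unique.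
apply/and3P; split; first exact/injectiveP.
  by apply/forallP => x; apply/forallP => j; apply/forallP => j'; apply/implyP/lta.
apply/forallP => j; apply/forallP => x; apply/forallP => x'; apply/implyP => xx'.
rewrite ltnNge; apply/negP => le.
(* The n + 1 entries, indexed by option 'I_n, with None for the entry a x' j. *)
pose e (o : option 'I_n) :=
  if o is Some i then (if i < j then a x' i else a x i) else a x' j.
have e_inj : injective e.
  have x'x : x' != x by rewrite neq_ltn xx' orbT.
  move=> [i|] [i'|] //=; [case: (ltnP i j) => ij; case: (ltnP i' j) => ij'
    | case: (ltnP i j) => ij | case: (ltnP i' j) => ij'];
    move=> /(a_inj (_, _) (_, _))-[] //.
  - by move=> ->.
  - by move=> xx; rewrite xx eqxx in x'x.
  - by move=> xx; rewrite xx eqxx in x'x.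
  - by move=> ->.
  - by move=> eij; rewrite eij ltnn in ij.
  - by move=> xx; rewrite xx eqxx in x'x.
  - by move=> eij; rewrite -eij ltnn in ij'.
  - by move=> xx; rewrite xx eqxx in x'x.
have P_val p : p \in e @: setT ->
    (exists2 i : 'I_n, i <= j & p = a x' i) \/ (exists2 i : 'I_n, j <= i & p = a x i).
  case/imsetP => -[i|] _ -> /=; last by left; exists j.
  by case: ltnP => ij; [left | right]; exists i => //; exact: ltnW.
have lea z (i i' : 'I_n) : i <= i' -> a z i <= a z i'.
  rewrite leq_eqVlt => /orP[/eqP/val_inj -> //|/lta/ltnW //].
apply: (f_ndec (e @: setT)) => [|p q].
  by rewrite card_imset // cardsT card_option card_ord.
move=> /P_val[] [i ij ->] /P_val[] [i' ij' ->]; rewrite !fa // => pq; first exact: ltnW.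
have e1 : a x i = a x' i'.
  apply/val_inj/eqP; rewrite eqn_leq pq /=.
  by apply: leq_trans (lea _ _ _ ij') _; apply: leq_trans le _; exact: lea.
by have := fa x i; rewrite e1 fa => ->.
Qed.

End Tableaux.

(** * The basis of column minors of standard fillings *)

Section StandardBasis.

Local Open Scope ring_scope.

Context {N m n : nat}.
Implicit Types (a b : 'M['I_N]_(m, n)) (f : {ffun 'I_N -> 'I_m}).

Lemma increasing_ord_ge (s : 'I_n -> 'I_n) :
  (forall i j : 'I_n, (i < j)%N -> (s i < s j)%N) -> forall j : 'I_n, (j <= s j)%N.
Proof.
move=> s_inc [j jn]; elim: j jn => // j IH jn.
apply: leq_ltn_trans (IH (ltnW jn)) _; exact: s_inc.
Qed.

(** Each row of a standard filling is recovered from the row word as the increasing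
    enumeration of a fibre. *)
Lemma row_word_inj {a b x0} : N = (m * n)%N -> standard_filling a -> standard_filling b ->
  row_word x0 a = row_word x0 b -> a = b.
Proof.
move=> hN sa sb ab.
have le a1 b1 : standard_filling a1 -> standard_filling b1 ->
    row_word x0 a1 = row_word x0 b1 -> forall x j, (a1 x j <= b1 x j)%N.
  move=> {sa sb ab} sa sb ab x j; have [h _ hK] := filling_bij hN sa.
  pose s i := (h (b1 x i)).2.
  have as_b i : a1 x (s i) = b1 x i.
    have := row_wordE x0 sb x i; rewrite -ab -{1}(hK (b1 x i)) row_wordE // => hx.
    by rewrite -[RHS]hK hx.
  have le_a (i i' : 'I_n) : (i <= i')%N -> (a1 x i <= a1 x i')%N.
    rewrite leq_eqVlt => /orP[/eqP/val_inj -> //|/(filling_row_lt sa x)/ltnW //].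
  rewrite -as_b; apply/le_a/increasing_ord_ge => i i' ii'.
  rewrite ltnNge; apply: contraL (filling_row_lt sb x i i' ii') => /le_a.
  by rewrite !as_b -leqNgt.
apply/matrixP => x j; apply/val_inj/eqP; rewrite eqn_leq.
by apply/andP; split; exact: le.
Qed.

(** The coordinates of [c] on the column minors are written as a matrix applied to the
    values of [c], which makes their linear dependence on [c] visible; this is what
    allows expanding a function of two words in each of them.  The matrix [B] is the
    inverse of the unitriangular matrix of the column minors at the row words.  The
    expansion is exact at the row words of standard fillings, hence everywhere, as
    the difference satisfies the Garnir relations. *)
Lemma standard_basis (x0 : 'I_m) : N = (m * n)%N ->
  exists B : 'M['I_N]_(m, n) -> 'M['I_N]_(m, n) -> int,
  forall c : {ffun 'I_N -> 'I_m} -> int, garnir n c -> forall f,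
    c f = \sum_(a | standard_filling a)
            (\sum_(b | standard_filling b) c (row_word x0 b) * B b a) * column_minors a f.
Proof.
move=> hN; pose std (a : 'M['I_N]_(m, n)) := standard_filling a.
pose w := @row_word N m n x0.
(* Nonstandard fillings are given the identity block, which lets the inverse be
   taken over the type of all fillings. *)
pose A a b := if std a && std b then column_minors a (w b) else (a == b)%:R : int.
have [||B BA] := @unitriangular_inverse _ (fun a => lexrank (w a)) A.
- move=> a; rewrite /A; case: ifP => [/andP[sa _]|_]; last by rewrite eqxx.
  exact: column_minors_row_word.
- move=> a b ab; rewrite /A; case: ifP => [/andP[sa sb] ne0|_]; last first.
    by rewrite (negPf ab).
  apply: column_minors_lexrank => //; apply: contra ab => /eqP wba.
  by apply/eqP; apply: (row_word_inj hN sa sb (esym wba)).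
exists B => c cG; pose x a := \sum_(b | std b) c (w b) * B b a.
suff c0 f : c f - \sum_(a | std a) x a * column_minors a f = 0.
  by move=> f; apply/eqP; rewrite -subr_eq0 c0.
apply: (@garnir_vanish _ _ n (fun f => c f - \sum_(a | std a) x a * column_minors a f)).
  by apply: garnir_sub => //; apply: garnir_sum => a; exact: column_minors_garnir.
move=> {}f /(standard_word_exists x0 _ hN)[b b_std <-]; have sb : std b by [].
apply/eqP; rewrite subr_eq0; apply/eqP.
under eq_bigr do rewrite mulr_suml.
rewrite exchange_big /=; under eq_bigr => d sd.
  under eq_bigr => a sa.
    rewrite -mulrA; have -> : column_minors a (w b) = A a b by rewrite /A sa sb.
    over.
  rewrite -mulr_sumr (_ : \sum_(a | std a) B d a * A a b = (d == b)%:R); last first.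
    rewrite -BA [RHS](bigID std) /= [X in _ + X]big1 ?addr0 // => a sa.
    rewrite /A (negPf sa) /= (_ : a == b = false) ?mulr0 //.
    by apply: contraNF sa => /eqP ->.
  over.
rewrite (bigD1 b) //= eqxx mulr1 big1 ?addr0 // => d /andP[_ /negPf ->].
by rewrite mulr0.
Qed.

Lemma prod_det (R : comNzRingType) (A : 'I_n -> 'M[R]_m) :
  \prod_(j < n) \det (A j) =
  \sum_(S : {ffun 'I_n -> 'S_m})
     (\prod_(j < n) (-1) ^+ S j) * \prod_(j < n) \prod_(i < m) A j i (S j i).
Proof.
rewrite /determinant bigA_distr_bigA /=.
by apply: eq_bigr => S _; rewrite big_split.
Qed.

Lemma column_minors_expansion {a} (R : comNzRingType) (X : 'I_N -> 'I_m -> R) :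
    N = (m * n)%N -> standard_filling a ->
  \prod_(j < n) \det (\matrix_(i < m, x < m) X (a i j) x) =
  \sum_f (column_minors a f)%:~R * \prod_p X p (f p).
Proof.
move=> hN sa; have [h aK hK] := filling_bij hN sa.
have ap (F : 'I_N -> R) : \prod_p F p = \prod_(j < n) \prod_(i < m) F (a i j).
  rewrite exchange_big pair_big /= (reindex (fun u : 'I_m * 'I_n => a u.1 u.2)) //.
  by apply: onW_bij; exists h.
under [RHS]eq_bigr => f _.
  rewrite /column_minors rmorph_prod /=.
  under eq_bigr do rewrite -det_map_mx.
  rewrite prod_det mulr_suml.
  over.
rewrite exchange_big prod_det /=; apply: eq_bigr => S _.
under [RHS]eq_bigr do rewrite -mulrA; rewrite -mulr_sumr; congr (_ * _).
pose G p x := (x == S (h p).2 (h p).1)%:R * X p x.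
have -> : \prod_(j < n) \prod_(i < m) (\matrix_(i0, x) X (a i0 j) x) i (S j i) =
          \prod_p \sum_x G p x.
  rewrite ap; apply: eq_bigr => j _; apply: eq_bigr => i _; rewrite mxE.
  rewrite /G (bigD1 (S j i)) //= (aK (i, j)) /= eqxx mul1r big1 ?addr0 // => x /negPf ->.
  by rewrite mul0r.
rewrite bigA_distr_bigA /=; apply: eq_bigr => f _.
rewrite /G big_split /=; congr (_ * _).
rewrite ap; apply: eq_bigr => j _; apply: eq_bigr => i _.
by rewrite !mxE (aK (i, j)) /= rmorph_nat.
Qed.

End StandardBasis.

(** * Determinants of entrywise products *)

Section ProductDeterminant.

Local Open Scope ring_scope.

Context {N m n : nat}.

Definition product_coefficient (a : 'I_N -> 'I_m) (b : 'I_N -> 'I_n)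
    (f : {ffun 'I_N -> 'I_m}) (g : {ffun 'I_N -> 'I_n}) : int :=
  \sum_(s : 'S_N) (-1) ^+ s *
    ((f == [ffun p => a (s p)])%:R * (g == [ffun p => b (s p)])%:R).

Context (a : 'I_N -> 'I_m) (b : 'I_N -> 'I_n).
Let C := product_coefficient a b.

Lemma rearrange_eq {k} (f : {ffun 'I_N -> 'I_k}) (u : 'I_N -> 'I_k) (s t : 'S_N) :
  (rearrange f t == [ffun p => u ((t * s)%g p)]) = (f == [ffun p => u (s p)]).
Proof.
apply/eqP/eqP => [/ffunP e|->]; apply/ffunP => p; rewrite ?ffunE ?permM //.
by have := e (t^-1%g p); rewrite !ffunE permM permKV.
Qed.

(** Multiplying the summation permutation by the transposition matches the terms of
    the two sums and changes each sign. *)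
Lemma product_coefficient_tperm f g p q : p != q ->
  C (rearrange f (tperm p q)) (rearrange g (tperm p q)) = - C f g.
Proof.
move=> pq; rewrite /C /product_coefficient (reindex_inj (mulgI (tperm p q))) /= -sumrN.
apply: eq_bigr => s _; rewrite !rearrange_eq odd_permM odd_tperm pq.
by rewrite signr_addb expr1 mulN1r mulNr.
Qed.

Lemma rearrange_tperm_id {k} {f : {ffun 'I_N -> 'I_k}} {p q : 'I_N} :
  f p = f q -> rearrange f (tperm p q) = f.
Proof. by move=> pq; apply/ffunP => i; rewrite ffunE; case: tpermP => // ->. Qed.

(** A transposition of two positions with equal letters in [g] does not change [g], so
    in [product_coefficient_tperm] it acts on the first word only. *)
Lemma product_coefficient_garnir_l g : garnir n (C^~ g).
Proof.
apply: (alternating_garnir g) => p q f pq gpq.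
by rewrite -{1}(rearrange_tperm_id gpq) product_coefficient_tperm.
Qed.

Lemma product_coefficient_garnir_r f : garnir m (C f).
Proof.
apply: (alternating_garnir f) => p q g pq fpq.
by rewrite -{1}(rearrange_tperm_id fpq) product_coefficient_tperm.
Qed.

Lemma det_product_expansion (R : comNzRingType) (X : 'I_N -> 'I_m -> R)
    (Y : 'I_N -> 'I_n -> R) :
  \det (\matrix_(i < N, j < N) (X i (a j) * Y i (b j))) =
  \sum_f \sum_g (C f g)%:~R * (\prod_p X p (f p) * \prod_p Y p (g p)).
Proof.
have delta (T : finType) (F : T -> R) x0 : \sum_x (x == x0)%:R * F x = F x0.
  rewrite (bigD1 x0) //= eqxx mul1r big1 ?addr0 // => x /negPf ->.
  by rewrite mul0r.
transitivity (\sum_f \sum_g \sum_(s : 'S_N)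
    ((-1) ^+ s * ((f == [ffun p => a (s p)])%:R * (g == [ffun p => b (s p)])%:R))%:~R
    * (\prod_p X p (f p) * \prod_p Y p (g p))); last first.
  apply: eq_bigr => f _; apply: eq_bigr => g _.
  by rewrite /C /product_coefficient rmorph_sum mulr_suml.
under [RHS]eq_bigr => f _ do rewrite exchange_big /=.
rewrite exchange_big /=; apply: eq_bigr => s _.
pose f0 := [ffun p => a (s p)]; pose g0 := [ffun p => b (s p)].
transitivity (\sum_f (f == f0)%:R * \sum_g (g == g0)%:R *
    ((-1) ^+ s * (\prod_p X p (f p) * \prod_p Y p (g p)))).
  rewrite !delta -big_split /=; congr (_ * _).
  by apply: eq_bigr => i _; rewrite mxE !ffunE.
apply: eq_bigr => f _; rewrite mulr_sumr; apply: eq_bigr => g _.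
rewrite !rmorphM /= !rmorph_nat rmorph_sign -/f0 -/g0.
by rewrite !mulrA; congr (_ * _ * _); rewrite mulrC mulrA.
Qed.

End ProductDeterminant.

(** The filling [v] has shape n x m: the columns of [v] are the rows of the tableau of
    shape m x n that is its transpose. *)
Lemma product_det_standard {N m n : nat} (x0 : 'I_m) (y0 : 'I_n)
    (a : 'I_N -> 'I_m) (b : 'I_N -> 'I_n) : N = m * n ->
  exists Phi : 'M['I_N]_(m, n) -> 'M['I_N]_(n, m) -> int,
  forall (R : comNzRingType) (X : 'I_N -> 'I_m -> R) (Y : 'I_N -> 'I_n -> R),
  (\det (\matrix_(i < N, j < N) (X i (a j) * Y i (b j))) =
   \sum_(u | standard_filling u) \sum_(v | standard_filling v)
     (Phi u v)%:~R
     * (\prod_(j < n) \det (\matrix_(i < m, x < m) X (u i j) x))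
     * (\prod_(i < m) \det (\matrix_(j < n, y < n) Y (v j i) y)))%R.
Proof.
move=> hN; have hN' : N = n * m by rewrite mulnC.
have [B B_basis] := @standard_basis N m n x0 hN.
have [B' B'_basis] := @standard_basis N n m y0 hN'.
pose C := product_coefficient a b; pose w := @row_word N m n x0; pose w' := @row_word N n m y0.
exists (fun u v => \sum_(u' | standard_filling u')
  (\sum_(v' | standard_filling v') C (w u') (w' v') * B' v' v) * B u' u)%R => R X Y.
rewrite det_product_expansion.
have CE f g : (C f g = \sum_(u | standard_filling u) \sum_(v | standard_filling v)
  (\sum_(u' | standard_filling u')
  (\sum_(v' | standard_filling v') C (w u') (w' v') * B' v' v) * B u' u)
   * (column_minors u f * column_minors v g))%R.
  rewrite [LHS](B_basis _ (product_coefficient_garnir_l a b g)); apply: eq_bigr => u su.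
  under eq_bigr => u' su'.
    rewrite [product_coefficient _ _ _ _](B'_basis _ (product_coefficient_garnir_r a b (w u'))).
    rewrite mulr_suml.
    over.
  rewrite exchange_big mulr_suml /=; apply: eq_bigr => v sv.
  rewrite !mulr_suml; apply: eq_bigr => u' su'.
  by rewrite -!mulrA; congr (_ * _)%R; rewrite mulrC -mulrA.
rewrite -/C.
transitivity (\sum_(f : {ffun 'I_N -> 'I_m}) \sum_(g : {ffun 'I_N -> 'I_n})
   \sum_(u | @standard_filling N m n u) \sum_(v | @standard_filling N n m v) (
  (\sum_(u' | @standard_filling N m n u')
  (\sum_(v' | @standard_filling N n m v') C (w u') (w' v') * B' v' v) * B u' u)%:~R *
   ((column_minors u f)%:~R * \prod_p X p (f p)) *
   ((column_minors v g)%:~R * \prod_p Y p (g p))))%R.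
  apply: eq_bigr => f _; apply: eq_bigr => g _; rewrite CE rmorph_sum mulr_suml /=.
  apply: eq_bigr => u _; rewrite rmorph_sum mulr_suml /=; apply: eq_bigr => v _.
  by rewrite !rmorphM /= -!mulrA; congr (_ * (_ * _))%R; rewrite mulrCA.
under eq_bigr => f _ do rewrite exchange_big /=.
rewrite exchange_big /=; apply: eq_bigr => u su.
under eq_bigr => f _ do rewrite exchange_big /=.
rewrite exchange_big /=; apply: eq_bigr => v sv.
rewrite (column_minors_expansion _ X hN su) (column_minors_expansion _ Y hN' sv).
rewrite -[RHS]mulrA big_distrlr mulr_sumr /=; apply: eq_bigr => f _.
by rewrite mulr_sumr; apply: eq_bigr => g _; rewrite -mulrA.
Qed.

(** * Monomials and the Vandermonde determinant *)

Lemma enum_increasing_image {m N : nat} (u : 'I_m -> 'I_N) :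
  (forall i j : 'I_m, i < j -> u i < u j) -> enum [set u i | i : 'I_m] = map u (enum 'I_m).
Proof.
move=> u_inc; have sorted_enum k : sorted (relpre val ltn) (enum 'I_k).
  by rewrite -sorted_map val_enum_ord iota_ltn_sorted.
have tr k : transitive (relpre (@nat_of_ord k) ltn) by move=> y x z; apply: ltn_trans.
apply: (@irr_sorted_eq _ (relpre val ltn)) => [||||p]; first exact: tr.
- by move=> p; rewrite /= ltnn.
- by rewrite /(enum _) -enumT; apply: sorted_filter; [exact: tr|exact: sorted_enum].
- by rewrite sorted_map; apply: sub_sorted (sorted_enum m) => i j; exact: u_inc.
by rewrite mem_enum; apply/imsetP/mapP => -[i _ ->]; exists i; rewrite ?mem_enum.
Qed.

(** The exponent lists of the box are characterized by a pointwise condition, which is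
    inherited by prefixes and suffixes: this is how a monomial splits into one in
    the first variables and one in the others. *)
Lemma mem_box (M e : seq nat) : (e \in box M) = all2 ltn e M.
Proof.
elim: M e => [|d M IH] [|x e] //=.
  by apply/negP => /allpairsP[[y f] []].
rewrite -IH; apply/allpairsP/andP => [[[y f] /= [+ fM [-> ->]]]|[xd eM]].
  by rewrite mem_iota.
by exists (x, e); rewrite mem_iota.
Qed.

Lemma mem_monomials (M e : seq nat) : (e \in monomials M) = all2 ltn e M.
Proof. by rewrite mem_sort mem_box. Qed.

Lemma all2_take {S T} (r : S -> T -> bool) k s t : all2 r s t -> all2 r (take k s) (take k t).
Proof.
by elim: s t k => [|x s IH] [|y t] [|k] //= /andP[-> st]; exact: IH.
Qed.

Lemma all2_drop {S T} (r : S -> T -> bool) k s t : all2 r s t -> all2 r (drop k s) (drop k t).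
Proof.
by elim: s t k => [|x s IH] [|y t] [|k] //= /andP[_ st]; exact: IH.
Qed.

Lemma monomial_eval_split (R : comNzRingType) k (e : seq nat) (z : seq R) : k <= size e ->
  monomial_eval e z =
  (monomial_eval (take k e) (take k z) * monomial_eval (drop k e) (drop k z))%R.
Proof.
move=> ke; rewrite /monomial_eval.
pose F t := (nth 0 z t ^+ nth 0%N e t)%R.
rewrite -(big_mkord predT F) (big_cat_nat (n := k)) //=; congr (_ * _)%R.
  rewrite size_takel // big_mkord; apply: eq_bigr => t _.
  by rewrite /F !nth_take.
rewrite -{1}(add0n k) big_addn size_drop big_mkord; apply: eq_bigr => t _.
by rewrite /F !nth_drop addnC.
Qed.

(** The size of the Vandermonde matrix is a product over the list of all bounds, which
    is equal but not convertible to the product of the two partial products. *)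
Lemma det_cast (R : comNzRingType) (M M' : nat) (F : nat -> nat -> R) : M = M' ->
  (\det (\matrix_(i < M, j < M) F i j) = \det (\matrix_(i < M', j < M') F i j))%R.
Proof. by move->. Qed.

Lemma mvandermonde_map {N : nat} (R : comNzRingType) (M : seq nat)
    (u : 'I_(\prod_(d <- M) d) -> 'I_N) (z : 'I_N -> seq R) :
  (mvandermonde M [seq z l | l <- map u (enum 'I_(\prod_(d <- M) d))] =
   \matrix_(i, j) monomial_eval (nth [::] (monomials M) j) (z (u i)))%R.
Proof.
apply/matrixP => i j; rewrite !mxE -map_comp (nth_map i) ?size_enum_ord //=.
by rewrite nth_ord_enum.
Qed.

Lemma standard_filling_tr {N m n : nat} (a : 'M['I_N]_(m, n)) :
  standard_filling a^T = standard_filling a.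
Proof.
rewrite /standard_filling; congr andb.
  apply/injectiveP/injectiveP => a_inj [i j] [i' j'] e.
    by have := a_inj (j, i) (j', i'); rewrite /= !mxE => /(_ e)[-> ->].
  by rewrite /= !mxE in e; have [-> ->] := a_inj (j, i) (j', i') e.
rewrite andbC; congr andb.
  by apply: eq_forallb => i; apply: eq_forallb => j; apply: eq_forallb => j'; rewrite !mxE.
by apply: eq_forallb => i; apply: eq_forallb => j; apply: eq_forallb => j'; rewrite !mxE.
Qed.

Theorem theorem2p3 (r k : nat) (N : r.-tuple nat)
    (hN : forall t : 'I_r, 2 <= tnth N t) (hk : 1 <= k < r) :
  let m := \prod_(d <- take k N) d in
  let n := \prod_(d <- drop k N) d in
  exists Phi : 'M['I_(m * n)]_(m, n) -> 'M['I_(m * n)]_(m, n) -> int,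
  forall (R : comNzRingType) (z : 'I_(m * n) -> r.-tuple R),
    (\det (mvandermonde N [seq (z l : seq R) | l <- enum 'I_(m * n)]) =
     \sum_(a | standard a) \sum_(b | standard b)
       (Phi a b)%:~R
       * (\prod_(i < n)
            \det (mvandermonde (take k N) [seq take k (z l) | l <- tab_col a i]))
       * (\prod_(j < m)
            \det (mvandermonde (drop k N) [seq drop k (z l) | l <- tab_row b j])))%R.
Proof.
move=> m n; have hmn : \prod_(d <- N) d = m * n.
  by rewrite -{1}(cat_take_drop k N) big_cat.
have mn_gt0 : 0 < m * n.
  rewrite -hmn big_seq prodn_cond_gt0 // => d /tnthP[t ->].
  exact: ltnW (hN t).
have [m_gt0 n_gt0] : 0 < m /\ 0 < n by move: mn_gt0; rewrite muln_gt0 => /andP[].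
pose e j := nth [::] (monomials N) j.
have eN j : j < m * n -> all2 ltn (e j) N.
  by move=> jmn; rewrite -mem_monomials mem_nth // size_monomials hmn.
(* The positions of the two factors of the j-th monomial in their lists; the
   default ordinals are never reached, by aE and bE. *)
pose a (j : 'I_(m * n)) : 'I_m :=
  insubd (Ordinal m_gt0) (index (take k (e j)) (monomials (take k N))).
pose b (j : 'I_(m * n)) : 'I_n :=
  insubd (Ordinal n_gt0) (index (drop k (e j)) (monomials (drop k N))).
have aE j : nth [::] (monomials (take k N)) (a j) = take k (e j).
  have mem : take k (e j) \in monomials (take k N) by rewrite mem_monomials all2_take ?eN.
  by move: (mem); rewrite -index_mem size_monomials -/m val_insubd => ->; exact: nth_index.
have bE j : nth [::] (monomials (drop k N)) (b j) = drop k (e j).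
  have mem : drop k (e j) \in monomials (drop k N) by rewrite mem_monomials all2_drop ?eN.
  by move: (mem); rewrite -index_mem size_monomials -/n val_insubd => ->; exact: nth_index.
have [Phi det_eq] := product_det_standard (Ordinal m_gt0) (Ordinal n_gt0) a b (erefl (m * n)).
exists (fun u v => Phi u v^T)%R => R z.
pose X (i : 'I_(m * n)) (x : 'I_m) :=
  monomial_eval (nth [::] (monomials (take k N)) x) (take k (z i)).
pose Y (i : 'I_(m * n)) (y : 'I_n) :=
  monomial_eval (nth [::] (monomials (drop k N)) y) (drop k (z i)).
pose F i j := monomial_eval (e j) (nth [::] [seq (z l : seq R) | l <- enum 'I_(m * n)] i).
rewrite [LHS](det_cast _ _ _ F hmn).
have -> : (\matrix_(i < m * n, j < m * n) F i j = \matrix_(i, j) (X i (a j) * Y i (b j)))%R.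
  apply/matrixP => i j; rewrite !mxE /F /X /Y aE bE (nth_map i) ?size_enum_ord //.
  rewrite nth_ord_enum -monomial_eval_split //.
  have := eN _ (ltn_ord j); rewrite all2E => /andP[/eqP -> _].
  by rewrite size_tuple; case/andP: hk => _ /ltnW.
rewrite det_eq; apply: eq_bigr => u su.
rewrite (reindex (fun v : 'M['I_(m * n)]_(m, n) => v^T)%R) /=; last first.
  by apply: onW_bij; exists trmx; exact: trmxK.
apply: eq_big => [v|v]; first exact: standard_filling_tr.
rewrite standard_filling_tr => sv; congr (_ * _ * _)%R.
  apply: eq_bigr => j _; congr (\det _)%R.
  rewrite /tab_col enum_increasing_image; last by move=> i i'; exact: (filling_column_lt su).
  by rewrite mvandermonde_map.
apply: eq_bigr => i _; rewrite /tab_row enum_increasing_image; last first.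
  by move=> j j'; exact: (filling_row_lt sv).
rewrite mvandermonde_map; congr (\det _)%R; apply/matrixP => j y.
by rewrite !mxE.
Qed.
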